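(* Let $(D,A_0)$ be an extended Hecke datum with $D=(W,S,A,(a_r)_{r\in S},(b_r)_{r\in S})$, let $\Gamma$ be a pre-$D$-graph, and let $\mathcal{R}=A\otimes_{A_0}(A_0[\Gamma]/J_0)$ be its quotient path algebra. Then there is a representation $\tilde\rho:\mathcal{H}(D)\to \mathrm{End}_A(\mathcal{R})$ of the Hecke algebra $\mathcal{H}(D)$ such that $\tilde\rho(T_r)=\tilde\rho_r$ for all $r\in S$.
   Context: Algebras are not required to have an identity. A Hecke datum $D=(W,S,A,(a_r)_{r\in S},(b_r)_{r\in S})$ consists of a Coxeter system $(W,S)$, a commutative unital ring $A$, and families $(a_r),(b_r)$ in $A$ with $a_r=a_s$, $b_r=b_s$ whenever $r,s\in S$ are conjugate in $W$. Let $m_{r,s}$ be the order of $rs$, and let $(xyx\cdots)_m$ denote the alternating product with $m$ factors. $\mathcal{H}(D)$ is the unital $A$-algebra generated by $T_r$ ($r\in S$) with relations $(T_rT_sT_r\cdots)_{m_{r,s}}=(T_sT_rT_s\cdots)_{m_{r,s}}$ (for $r\ne s$, $m_{r,s}<\infty$) and $(T_r-a_r)(T_r+b_r)=0$. An extended Hecke datum $(D,A_0)$ is a Hecke datum with a subring $A_0\subseteq A$, $1_{A_0}=1_A$, such that $A$ is a free $A_0$-module with some basis $\{c_i\}_{i\in I}$. A quiver has vertex set $V$, edge set $E$, source and target maps $s,t$; an edge $e$ with target $x$ and source $y$ is written $x\xleftarrow{e}y$. Paths are sequences $(e_1,\dots,e_n)$ with $s(e_i)=t(e_{i+1})$, with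 target $t(e_1)$ and source $s(e_n)$; paths of length $0$ are the vertices. The path algebra $A[\Gamma]$ (similarly $A_0[\Gamma]$) is the free module on the set $P$ of paths, with product $pq$ = concatenation if $s(p)=t(q)$, and $0$ otherwise; $A[\Gamma]=A\otimes_{A_0}A_0[\Gamma]$. A pre-$D$-graph is a quiver $\Gamma$ with a map $\mathcal{L}:V\to\mathcal{P}(S)$ (power set) such that for any $x\in V$, $r\in S$ with $r\notin\mathcal{L}(x)$ there are only finitely many $y\in V$, $e\in E$ with $r\in\mathcal{L}(y)$ and $x\xleftarrow{e}y$. For $r\in S$, $\rho_r$ is the left $A[\Gamma]$-module endomorphism of $A[\Gamma]$ with $\rho_r(x)=a_rx+\sum_{y,e\,:\,x\xleftarrow{e}y,\ r\in\mathcal{L}(y)}(x\xleftarrow{e}y)$ if $r\notin\mathcal{L}(x)$ and $\rho_r(x)=-b_rx$ if $r\in\mathcal{L}(x)$, for $x\in V$. For $x\in V$ and $r\neq s$ in $S$ with $m_{r,s}<\infty$ define $X^{r,s,x}_{p,i}\in A_0$ by $\big((\rho_r\rho_s\rho_r\cdots)_{m_{r,s}}-(\rho_s\rho_r\rho_s\cdots)_{m_{r,s}}\big)(x)=\sum_{i\in I}\sum_{p\in P}c_iX^{r,s,x}_{p,i}\,p$. $J_0$ is the two-sided ideal of $A_0[\Gamma]$ generated by all elements $\sum_pX^{r,s,x}_{p,i}p$ (it does not depend on the basis). $\mathcal{R}_0=A_0[\Gamma]/J_0$, $\mathcal{R}=A\otimes_{A_0}\mathcal{R}_0=A[\Gamma]/J$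 with $J=A\otimes_{A_0}J_0$; $[p]$ denotes the class of $p$. $\tilde\rho_r$ is the left $\mathcal{R}$-module endomorphism of $\mathcal{R}$ determined by $\tilde\rho_r([x])=a_r[x]+\sum_{y,e\,:\,x\xleftarrow{e}y,\ r\in\mathcal{L}(y)}[x\xleftarrow{e}y]$ if $r\notin\mathcal{L}(x)$ and $\tilde\rho_r([x])=-b_r[x]$ if $r\in\mathcal{L}(x)$, for $x\in V$ (left $\mathcal{R}$-module endomorphisms of $\mathcal{R}$ are determined by freely chosen images of $[x]$ in $[x]\mathcal{R}$). *)

(* Defs.v *)
From HB Require Import structures.
From mathcomp Require Import all_boot all_order all_algebra.
From mathcomp Require Import generic_quotient ring_quotient finmap.
From mathcomp Require Import boolp classical_sets functions cardinality fsbigop.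

Set Implicit Arguments.
Unset Strict Implicit.
Unset Printing Implicit Defensive.
Import GRing.Theory.
Local Open Scope classical_set_scope.
Local Open Scope ring_scope.

Reserved Notation "x ** y" (at level 40, left associativity).

(* Associative algebras without identity, over a commutative ring that may be
   the zero ring (which rules out the algType hierarchy of the library). *)
HB.mixin Record Lmodule_isNAlgebra (R : comPzRingType) V
    of GRing.Lmodule R V := {
  nmul : V -> V -> V;
  nmulA : associative nmul;
  nmulDl : left_distributive nmul +%R;
  nmulDr : right_distributive nmul +%R;
  nmulZl : forall (a : R) u v, nmul (a *: u) v = a *: nmul u v;
  nmulZr : forall (a : R) u v, nmul u (a *: v) = a *: nmul u v
}.
#[short(type="nalgType")]
HB.structure Definition NAlgebra (R : comPzRingType) :=
  {V of GRing.Lmodule R V & Lmodule_isNAlgebra R V}.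
Notation "u ** v" := (nmul u v) : ring_scope.

HB.mixin Record NAlgebra_isUnital (R : comPzRingType) V of NAlgebra R V := {
  nid : V;
  nmul1l : left_id nid nmul;
  nmul1r : right_id nid nmul
}.
#[short(type="ualgType")]
HB.structure Definition UAlgebra (R : comPzRingType) :=
  {V of NAlgebra R V & NAlgebra_isUnital R V}.
Arguments nid {R s}.

Section NAlgebraTheory.
Context (R : comPzRingType) (V : nalgType R).
Implicit Types u v : V.

Lemma nmulBl u1 u2 v : (u1 - u2) ** v = u1 ** v - u2 ** v.
Proof. by rewrite -scaleN1r nmulDl nmulZl scaleN1r. Qed.

Lemma nmulBr u v1 v2 : u ** (v1 - v2) = u ** v1 - u ** v2.
Proof. by rewrite -scaleN1r nmulDr nmulZr scaleN1r. Qed.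

Lemma nmul0l v : (0 : V) ** v = 0.
Proof. by rewrite -[X in X ** _](subrr v) nmulBl subrr. Qed.

Lemma nmul0r v : v ** (0 : V) = 0.
Proof. by rewrite -[X in _ ** X](subrr v) nmulBr subrr. Qed.

Lemma nmul_suml I r (P : pred I) (F : I -> V) v :
  (\sum_(i <- r | P i) F i) ** v = \sum_(i <- r | P i) F i ** v.
Proof.
by apply: (big_morph (fun u => u ** v)); [move=> x y; exact: nmulDl|exact: nmul0l].
Qed.

Lemma nmul_sumr I r (P : pred I) (F : I -> V) v :
  v ** (\sum_(i <- r | P i) F i) = \sum_(i <- r | P i) v ** F i.
Proof.
by apply: (big_morph (nmul v)); [move=> x y; exact: nmulDr|exact: nmul0r].
Qed.

End NAlgebraTheory.

(* A representation of H on M, i.e. a morphism of unital R-algebras from H to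
   End_R(M). *)
Record representation (R : comPzRingType) (H : ualgType R) (M : lmodType R) :=
  Representation {
    rep_fun :> H -> {linear M -> M};
    rep1 : forall v, rep_fun nid v = v;
    repM : forall h k v, rep_fun (h ** k) v = rep_fun h (rep_fun k v);
    repD : forall h k v, rep_fun (h + k) v = rep_fun h v + rep_fun k v;
    repZ : forall a h v, rep_fun (a *: h) v = a *: rep_fun h v
  }.

Definition left_endo (R : comPzRingType) (V : nalgType R) (f : V -> V) :=
  forall u v, f (u ** v) = u ** f v.

Record ideal (R : comPzRingType) (V : nalgType R) := Ideal {
  ideal_set :> V -> Prop;
  ideal0 : ideal_set 0;
  idealD : forall x y, ideal_set x -> ideal_set y -> ideal_set (x + y);
  idealZ : forall a x, ideal_set x -> ideal_set (a *: x);
  ideal_mull : forall u x, ideal_set x -> ideal_set (u ** x);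
  ideal_mulr : forall u x, ideal_set x -> ideal_set (x ** u)
}.

Section IdealGen.
Context (R : comPzRingType) (V : nalgType R) (G : set V).

Definition ideal_gen_set : set V :=
  [set x | forall I : ideal V, G `<=` ideal_set I -> I x].

Definition ideal_gen : ideal V := @Ideal R V ideal_gen_set
  (fun I _ => ideal0 I)
  (fun x y Gx Gy I GI => idealD (Gx I GI) (Gy I GI))
  (fun a x Gx I GI => idealZ a (Gx I GI))
  (fun u x Gx I GI => ideal_mull u (Gx I GI))
  (fun u x Gx I GI => ideal_mulr u (Gx I GI)).

End IdealGen.

Section QuotientAlgebra.
Context (R : comPzRingType) (V : nalgType R) (I : ideal V).

Definition ideal_mem : {pred V} := fun x => `[< I x >].

Lemma ideal_memP x : reflect (I x) (x \in ideal_mem).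
Proof. exact: asboolP. Qed.

Lemma ideal_mem_submod : GRing.subsemimod_closed ideal_mem.
Proof.
split; first split.
- by apply/ideal_memP; exact: ideal0.
- by move=> x y /ideal_memP Ix /ideal_memP Iy; apply/ideal_memP; exact: idealD.
- by move=> a x /ideal_memP Ix; apply/ideal_memP; exact: idealZ.
Qed.

HB.instance Definition _ :=
  GRing.isSubmodClosed.Build R V ideal_mem ideal_mem_submod.

Definition quot_alg : Type := Quotient.quot ideal_mem.
HB.instance Definition _ := GRing.Zmodule.on quot_alg.

Definition qclass (v : V) : quot_alg := \pi_(Quotient.quot ideal_mem)%qT v.
Definition qrepr (u : quot_alg) : V :=
  repr (u : Quotient.quot ideal_mem).

Lemma qreprK u : qclass (qrepr u) = u.
Proof. exact: reprK. Qed.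

Lemma qclassP v w : qclass v = qclass w <-> I (v - w).
Proof.
split=> [/eqP|Ivw]; last apply/eqP; rewrite /qclass -Quotient.idealrBE.
  by move/ideal_memP.
exact/ideal_memP.
Qed.

Lemma qclassD v w : qclass (v + w) = qclass v + qclass w.
Proof. exact: (Quotient.pi_add ideal_mem). Qed.

Lemma qclass0P v : qclass v = 0 <-> I v.
Proof.
have -> : (0 : quot_alg) = qclass 0.
  by apply: (addrI (qclass 0)); rewrite -qclassD !addr0.
by rewrite qclassP subr0.
Qed.

Definition qscale (a : R) (u : quot_alg) := qclass (a *: qrepr u).
Definition qmul (u v : quot_alg) := qclass (qrepr u ** qrepr v).

Lemma qrepr_class v : I (qrepr (qclass v) - v).
Proof. by apply/qclassP; rewrite qreprK. Qed.

Lemma qscale_class a v : qscale a (qclass v) = qclass (a *: v).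
Proof. by apply/qclassP; rewrite -scalerBr; apply/idealZ/qrepr_class. Qed.

Lemma qmul_class v w : qmul (qclass v) (qclass w) = qclass (v ** w).
Proof.
apply/qclassP; set v' := qrepr _; set w' := qrepr _.
have -> : v' ** w' - v ** w = v' ** (w' - w) + (v' - v) ** w.
  by rewrite nmulBr nmulBl addrA subrK.
by apply: idealD; [apply: ideal_mull|apply: ideal_mulr]; exact: qrepr_class.
Qed.

Let qscaleA a b u : qscale a (qscale b u) = qscale (a * b) u.
Proof. by rewrite -[u]qreprK !qscale_class scalerA. Qed.
Let qscale1 : left_id 1 qscale.
Proof. by move=> u; rewrite -[u]qreprK qscale_class scale1r. Qed.
Let qscaleDr : right_distributive qscale +%R.
Proof.
move=> a u v; rewrite -[u]qreprK -[v]qreprK -qclassD !qscale_class scalerDr.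
exact: qclassD.
Qed.
Let qscaleDl v : {morph qscale^~ v: a b / a + b}.
Proof. by move=> a b /=; rewrite -[v]qreprK !qscale_class scalerDl qclassD. Qed.

HB.instance Definition _ := GRing.Zmodule_isLmodule.Build R quot_alg
  qscaleA qscale1 qscaleDr qscaleDl.

Lemma qclassZ a v : qclass (a *: v) = a *: qclass v.
Proof. by rewrite -qscale_class. Qed.

Let qmulA : associative qmul.
Proof.
move=> u v w; rewrite -[u]qreprK -[v]qreprK -[w]qreprK !qmul_class.
by rewrite nmulA.
Qed.
Let qmulDl : left_distributive qmul +%R.
Proof.
move=> u v w; rewrite -[u]qreprK -[v]qreprK -[w]qreprK -qclassD !qmul_class.
by rewrite nmulDl qclassD.
Qed.
Let qmulDr : right_distributive qmul +%R.
Proof.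
move=> u v w; rewrite -[u]qreprK -[v]qreprK -[w]qreprK -qclassD !qmul_class.
by rewrite nmulDr qclassD.
Qed.
Let qmulZl a u v : qmul (a *: u) v = a *: qmul u v.
Proof.
by rewrite -[u]qreprK -[v]qreprK -qclassZ !qmul_class nmulZl qclassZ.
Qed.
Let qmulZr a u v : qmul u (a *: v) = a *: qmul u v.
Proof.
by rewrite -[u]qreprK -[v]qreprK -qclassZ !qmul_class nmulZr qclassZ.
Qed.

HB.instance Definition _ := Lmodule_isNAlgebra.Build R quot_alg
  qmulA qmulDl qmulDr qmulZl qmulZr.

Lemma qclassM v w : qclass (v ** w) = qclass v ** qclass w.
Proof. by rewrite -[RHS]/(qmul _ _) qmul_class. Qed.

Let qclass_linear : linear qclass.
Proof. by move=> a v w; rewrite qclassD qclassZ. Qed.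
HB.instance Definition _ := GRing.isLinear.Build R V quot_alg _ qclass
  qclass_linear.

(* The endomorphism of V / I induced by an endomorphism of V preserving I. *)
Section Induced.
Context (f : {linear V -> V}) (fI : forall x, I x -> I (f x)).

Definition qmap (u : quot_alg) : quot_alg := qclass (f (qrepr u)).

Lemma qmap_class v : qmap (qclass v) = qclass (f v).
Proof. by apply/qclassP; rewrite -linearB; apply/fI/qrepr_class. Qed.

Lemma qmap_linear : linear qmap.
Proof.
move=> a u v; rewrite -[u]qreprK -[v]qreprK -linearP !qmap_class.
by rewrite !linearP.
Qed.

Definition quot_map : {linear quot_alg -> quot_alg} :=
  HB.pack qmap (GRing.isLinear.Build R quot_alg quot_alg _ qmap qmap_linear).

End Induced.
End QuotientAlgebra.

Section FreeModule.
Context (A : comPzRingType) (K : choiceType).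

Definition fin_supp : {pred K -> A} :=
  fun f => `[< finite_set [set k | f k != 0] >].

Lemma fin_supp_zmod : zmod_closed fin_supp.
Proof.
split=> [|f g /asboolP ff /asboolP fg]; apply/asboolP.
  by apply: sub_finite_set (@finite_set0 K) => k /=; rewrite eqxx.
apply: sub_finite_set (_ : finite_set ([set k | f k != 0] `|` [set k | g k != 0])).
  move=> k /= fgk; case: (eqVneq (f k) 0) => [fk0|]; last by left.
  right; apply: contraNN fgk => /eqP gk0.
  by rewrite -[(f - g) k]/(f k - g k) fk0 gk0 subr0.
by rewrite finite_setU.
Qed.

HB.instance Definition _ := GRing.isZmodClosed.Build (K -> A) fin_supp
  fin_supp_zmod.

Record free_mod := FreeMod { fcoef :> K -> A; fcoefP : fcoef \in fin_supp }.

HB.instance Definition _ := [isSub for fcoef].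
HB.instance Definition _ := [Choice of free_mod by <:].
HB.instance Definition _ := [SubChoice_isSubZmodule of free_mod by <:].

Lemma fcoef_finite (v : free_mod) : finite_set [set k | v k != 0].
Proof. by case: v => v /= /asboolP. Qed.

Lemma free_modP (v w : free_mod) : (forall k, v k = w k) -> v = w.
Proof. by move=> vw; apply/val_inj/funext. Qed.

Lemma fcoefD (v w : free_mod) k : (v + w) k = v k + w k.
Proof. by []. Qed.

Lemma fcoef0 k : (0 : free_mod) k = 0.
Proof. by []. Qed.

Lemma fscale_subproof a (v : free_mod) : (fun k => a * v k) \in fin_supp.
Proof.
apply/asboolP; apply: sub_finite_set (fcoef_finite v) => k /=.
by apply: contraNN => /eqP ->; rewrite mulr0.
Qed.

Definition fscale a v := FreeMod (fscale_subproof a v).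

Let fscaleA a b v : fscale a (fscale b v) = fscale (a * b) v.
Proof. by apply: free_modP => k /=; rewrite mulrA. Qed.
Let fscale1 : left_id 1 fscale.
Proof. by move=> v; apply: free_modP => k /=; rewrite mul1r. Qed.
Let fscaleDr : right_distributive fscale +%R.
Proof. by move=> a u v; apply: free_modP => k; exact: mulrDr. Qed.
Let fscaleDl v : {morph fscale^~ v: a b / a + b}.
Proof. by move=> a b; apply: free_modP => k; exact: mulrDl. Qed.

HB.instance Definition _ := GRing.Zmodule_isLmodule.Build A free_mod
  fscaleA fscale1 fscaleDr fscaleDl.

Lemma fcoefZ a (v : free_mod) k : (a *: v) k = a * v k.
Proof. by []. Qed.

Lemma fbasis_subproof (k : K) :
  (fun j => if j == k then 1 else 0 : A) \in fin_supp.
Proof.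
apply/asboolP; apply: sub_finite_set (finite_set1 k) => j /=.
by case: (eqVneq j k) => // _; rewrite eqxx.
Qed.

Definition fbasis k : free_mod := FreeMod (fbasis_subproof k).

(* The linear extension of g : K -> M, sending v to the (finite) sum of the
   v k *: g k. *)
Section LinearExtension.
Context (M : lmodType A) (g : K -> M).

Definition lext_fun (v : free_mod) : M := \sum_(k \in [set: K]) v k *: g k.

Lemma lext_fset (X : {fset K}) (v : free_mod) :
  (forall k, v k != 0 -> k \in X) -> lext_fun v = \sum_(k <- X) v k *: g k.
Proof.
move=> vX; apply: fsbigTE => k kX.
case: (eqVneq (v k) 0) => [->|/vX]; first by rewrite scale0r.
by rewrite (negPf kX).
Qed.

Lemma lext_linear : linear lext_fun.
Proof.
move=> a v w.
pose X : {fset K} := (fset_set [set k | v k != 0%R] `|` fset_set [set k | w k != 0%R])%fset.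
have vX k : v k != 0 -> k \in X.
  by move=> vk; rewrite in_fsetU in_fset_set ?mem_set//; exact: fcoef_finite.
have wX k : w k != 0 -> k \in X.
  move=> wk; rewrite in_fsetU orbC in_fset_set ?mem_set//; exact: fcoef_finite.
rewrite (lext_fset vX) (lext_fset wX) (@lext_fset X); last first.
  move=> k; rewrite -[fcoef _ k]/(a * v k + w k) => vwk.
  case: (eqVneq (v k) 0) => [vk0|/vX//].
  by apply: wX; apply: contraNN vwk => /eqP ->; rewrite vk0 mulr0 addr0.
rewrite scaler_sumr -big_split; apply: eq_bigr => k _ /=.
by rewrite scalerA -scalerDl.
Qed.

HB.instance Definition _ := GRing.isLinear.Build A free_mod M _ lext_fun
  lext_linear.

Definition lext : {linear free_mod -> M} := lext_fun.

Lemma lext_basis k : lext (fbasis k) = g k.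
Proof.
rewrite /lext /= (@lext_fset [fset k]%fset) ?big_seq_fset1 /= ?eqxx ?scale1r//.
by move=> j /=; rewrite inE; case: (eqVneq j k); rewrite // eqxx.
Qed.

End LinearExtension.

Lemma free_modE (v : free_mod) : v = lext fbasis v.
Proof.
pose X : {fset K} := fset_set [set k | v k != 0%R].
have vX k : (k \in X) = (v k != 0).
  by rewrite in_fset_set; [exact: asboolb|exact: fcoef_finite].
rewrite /lext /= (@lext_fset _ _ X) => [|k]; last by rewrite vX.
apply: free_modP => k.
have -> : (\sum_(j <- X) v j *: fbasis j : free_mod) k =
          \sum_(j <- X) (if k == j then v j else 0).
  apply: (big_ind2 (fun (x : free_mod) y => x k = y)) => //.
    by move=> x1 x2 y1 y2 <- <-.
  by move=> j _; rewrite fcoefZ /=; case: eqP; rewrite ?mulr1 ?mulr0.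
case: (boolP (k \in X)) => kX.
  by rewrite (big_fsetD1 k)//= eqxx big1_fset ?addr0// => j; rewrite !inE eq_sym => /andP[/negPf->].
rewrite big1_fset => [|j jX _]; last by case: eqP kX => // ->; rewrite jX.
by move: kX; rewrite vX negbK => /eqP.
Qed.

Lemma lextE (M : lmodType A) (g : K -> M) v :
  lext g v = \sum_(k <- fset_set [set k | v k != 0%R]) v k *: g k.
Proof.
by apply: lext_fset => k vk; rewrite in_fset_set ?mem_set//; exact: fcoef_finite.
Qed.

Lemma free_mod_ind (P : free_mod -> Prop) :
  P 0 -> (forall k, P (fbasis k)) ->
  (forall a v w, P v -> P w -> P (a *: v + w)) -> forall v, P v.
Proof.
move=> P0 Pb PL v; rewrite [v]free_modE lextE.
elim: (fset_set _ : seq K) => [|k s IHs]; first by rewrite big_nil.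
by rewrite big_cons; apply: PL.
Qed.

Lemma lext_unique (M : lmodType A) (f h : {linear free_mod -> M}) :
  (forall k, f (fbasis k) = h (fbasis k)) -> f =1 h.
Proof.
move=> fh; elim/free_mod_ind => // [|a v w IHv IHw]; first by rewrite !linear0.
by rewrite !linearP IHv IHw.
Qed.

End FreeModule.

(* The product on the free module with basis K that extends bilinearly a
   partial product op of the basis, undefined products being 0. *)
Section PartialProduct.
Context (A : comPzRingType) (K : choiceType) (op : K -> K -> option K).

Definition pprod_basis (p q : K) : free_mod A K := oapp (@fbasis A K) 0 (op p q).

Definition pprod (u v : free_mod A K) : free_mod A K :=
  lext (fun p => lext (pprod_basis p) v) u.

Lemma pprodE p q : pprod (fbasis A p) (fbasis A q) = pprod_basis p q.
Proof. by rewrite /pprod !lext_basis. Qed.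

Lemma pprodPl a u v w : pprod (a *: u + v) w = a *: pprod u w + pprod v w.
Proof. by rewrite /pprod linearP. Qed.

Lemma pprodPr a u v w : pprod u (a *: v + w) = a *: pprod u v + pprod u w.
Proof.
rewrite /pprod !lextE scaler_sumr -big_split; apply: eq_bigr => k _ /=.
by rewrite linearP scalerDr !scalerA [a * _]mulrC.
Qed.

Lemma pprodDl : left_distributive pprod +%R.
Proof. by move=> u v w; rewrite -[u]scale1r pprodPl !scale1r. Qed.

Lemma pprodDr : right_distributive pprod +%R.
Proof. by move=> u v w; rewrite -[v]scale1r pprodPr !scale1r. Qed.

Lemma pprod0l v : pprod 0 v = 0.
Proof. by apply: (addrI (pprod 0 v)); rewrite -pprodDl !addr0. Qed.

Lemma pprod0r v : pprod v 0 = 0.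
Proof. by apply: (addrI (pprod v 0)); rewrite -pprodDr !addr0. Qed.

Lemma pprodZl a u v : pprod (a *: u) v = a *: pprod u v.
Proof. by rewrite -[a *: u]addr0 pprodPl pprod0l addr0. Qed.

Lemma pprodZr a u v : pprod u (a *: v) = a *: pprod u v.
Proof. by rewrite -[a *: v]addr0 pprodPr pprod0r addr0. Qed.

Hypothesis opA : forall p q r,
  obind (fun pq => op pq r) (op p q) = obind (fun qr => op p qr) (op q r).

Lemma pprodA : associative pprod.
Proof.
move=> u v w.
elim/free_mod_ind: u => [|p|a u1 u2 IH1 IH2]; first by rewrite !pprod0l.
  elim/free_mod_ind: v => [|q|a v1 v2 IH1 IH2]; first by rewrite pprod0l !pprod0r pprod0l.
    elim/free_mod_ind: w => [|r|a w1 w2 IH1 IH2]; first by rewrite !pprod0r.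
      rewrite !pprodE /pprod_basis; have := opA p q r.
      case: (op p q) => [pq|] /=; case: (op q r) => [qr|] /= E.
      + by rewrite !pprodE /pprod_basis E.
      + by rewrite pprod0r pprodE /pprod_basis E.
      + by rewrite pprod0l pprodE /pprod_basis -E.
      + by rewrite pprod0l pprod0r.
    by rewrite !pprodPr IH1 IH2.
  by rewrite !(pprodPl, pprodPr) IH1 IH2.
by rewrite !pprodPl IH1 IH2.
Qed.

End PartialProduct.

Record quiver := Quiver {
  vertex : choiceType;
  edge : choiceType;
  source : edge -> vertex;
  target : edge -> vertex
}.

Section Paths.
Context (Q : quiver).

(* (x, [:: e_1; ...; e_n]) stands for the path (e_1, ..., e_n) with target x,
   and for the vertex x if n = 0. *)
Fixpoint is_path (x : vertex Q) (es : seq (edge Q)) : bool :=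
  if es is e :: es' then (target e == x) && is_path (source e) es' else true.

Record qpath := QPath {
  path_val : vertex Q * seq (edge Q);
  path_valP : is_path path_val.1 path_val.2
}.

HB.instance Definition _ := [isSub for path_val].
HB.instance Definition _ := [Choice of qpath by <:].

Definition path_target (p : qpath) : vertex Q := (path_val p).1.
Definition path_edges (p : qpath) : seq (edge Q) := (path_val p).2.
Definition path_source (p : qpath) : vertex Q :=
  last (path_target p) [seq source e | e <- path_edges p].

Definition vertex_path (x : vertex Q) : qpath := @QPath (x, [::]) isT.

Lemma edge_path_subproof (e : edge Q) : is_path (target e) [:: e].
Proof. by rewrite /= eqxx. Qed.
Definition edge_path (e : edge Q) : qpath :=
  @QPath (target e, [:: e]) (edge_path_subproof e).

Definition path_cat (p q : qpath) : option qpath :=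
  if path_source p == path_target q
  then insub (path_target p, path_edges p ++ path_edges q) else None.

Lemma is_path_cat x s t :
  is_path x (s ++ t) =
  is_path x s && is_path (last x [seq source e | e <- s]) t.
Proof. by elim: s x => //= e s IHs x; rewrite IHs andbA. Qed.

Variant path_cat_spec p q : option qpath -> Prop :=
| PathCatSome pq of path_source p = path_target q
    & path_target pq = path_target p
    & path_edges pq = path_edges p ++ path_edges q
    & path_source pq = path_source q : path_cat_spec p q (Some pq)
| PathCatNone of path_source p <> path_target q : path_cat_spec p q None.

Lemma path_catP p q : path_cat_spec p q (path_cat p q).
Proof.
rewrite /path_cat; case: eqP => [E|]; last by constructor.
have pq : is_path (path_target p, path_edges p ++ path_edges q).1
                  (path_target p, path_edges p ++ path_edges q).2.
  by rewrite /= is_path_cat -/(path_source p) E (path_valP p) (path_valP q).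
by rewrite insubT /=; constructor => //; rewrite /path_source /= map_cat last_cat -/(path_source p) E.
Qed.

Lemma qpath_inj p q :
  path_target p = path_target q -> path_edges p = path_edges q -> p = q.
Proof.
by case: p q => [[x s] xs] [[y t] yt] /= ? ?; apply/val_inj; congr pair.
Qed.

Lemma path_catA p q r :
  obind (fun pq => path_cat pq r) (path_cat p q) =
  obind (fun qr => path_cat p qr) (path_cat q r).
Proof.
case: path_catP => [pq Epq tpq epq spq|Npq]; case: path_catP => [qr Eqr tqr eqr sqr|Nqr] //=.
- case: path_catP => [u _ tu eu _|]; last by rewrite spq.
  case: path_catP => [v _ tv ev _|]; last by rewrite tqr.
  by congr Some; apply: qpath_inj; [rewrite tu tv|rewrite eu ev epq eqr catA].
- by case: path_catP => // u; rewrite spq.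
- by case: path_catP => // u; rewrite tqr.
Qed.

Lemma path_cat_vertexl p : path_cat (vertex_path (path_target p)) p = Some p.
Proof.
case: path_catP => [u _ tu eu _|]; last by [].
by congr Some; apply: qpath_inj.
Qed.

Lemma path_cat_vertexr p : path_cat p (vertex_path (path_source p)) = Some p.
Proof.
case: path_catP => [u _ tu eu _|]; last by [].
by congr Some; apply: qpath_inj => //; rewrite eu cats0.
Qed.

End Paths.

Section PathAlgebra.
Context (A : comPzRingType) (Q : quiver).

Definition path_alg : Type := free_mod A (qpath Q).
HB.instance Definition _ := GRing.Lmodule.on path_alg.
HB.instance Definition _ := Lmodule_isNAlgebra.Build A path_alg
  (@pprodA A _ _ (@path_catA Q)) (@pprodDl A _ _) (@pprodDr A _ _)
  (@pprodZl A _ _) (@pprodZr A _ _).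

Definition pbasis (p : qpath Q) : path_alg := fbasis A p.

Lemma pbasisM p q : pbasis p ** pbasis q = oapp pbasis 0 (path_cat p q).
Proof. exact: pprodE. Qed.

(* The left path_alg-module endomorphism with x |-> g x, for g x in
   x ** path_alg *)
Definition left_ext (g : vertex Q -> path_alg) : {linear path_alg -> path_alg} :=
  @lext A _ path_alg (fun p => pbasis p ** g (path_source p)).

Lemma left_ext_basis g p :
  left_ext g (pbasis p) = pbasis p ** g (path_source p).
Proof. exact: lext_basis. Qed.

Lemma left_ext_endo g : left_endo (left_ext g).
Proof.
move=> u v; elim/free_mod_ind: u => [|p|a u1 u2 IH1 IH2].
- by rewrite !(nmul0l, linear0).
- elim/free_mod_ind: v => [|q|a v1 v2 IH1 IH2].
  + by rewrite !(nmul0r, linear0).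
  + rewrite -/(pbasis p) -/(pbasis q) pbasisM left_ext_basis nmulA pbasisM.
    case: path_catP => [pq _ _ _ spq|_] /=; last by rewrite linear0 nmul0l.
    by rewrite left_ext_basis spq.
  + by rewrite linearP nmulDr nmulZr linearP IH1 IH2 nmulDr nmulZr.
- by rewrite nmulDl nmulZl linearP IH1 IH2 nmulDl nmulZl.
Qed.

Lemma left_ext_vertex g x : pbasis (vertex_path x) ** g x = g x ->
  left_ext g (pbasis (vertex_path x)) = g x.
Proof. by rewrite left_ext_basis. Qed.

End PathAlgebra.

Section FreeAlgebra.
Context (A : comPzRingType) (S : choiceType).

Definition free_alg : Type := free_mod A (seq S).

Definition word_cat (s t : seq S) := Some (s ++ t).
Lemma word_catA s t u :
  obind (fun st => word_cat st u) (word_cat s t) =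
  obind (fun tu => word_cat s tu) (word_cat t u).
Proof. by rewrite /word_cat /= catA. Qed.

HB.instance Definition _ := GRing.Lmodule.on free_alg.
HB.instance Definition _ := Lmodule_isNAlgebra.Build A free_alg
  (@pprodA A _ _ word_catA) (@pprodDl A _ _) (@pprodDr A _ _)
  (@pprodZl A _ _) (@pprodZr A _ _).

Definition word (s : seq S) : free_alg := fbasis A s.

Lemma wordM s t : word s ** word t = word (s ++ t).
Proof. exact: pprodE. Qed.

Lemma word_nill : left_id (word [::]) nmul.
Proof.
elim/free_mod_ind => [|s|a u v IHu IHv]; first by rewrite nmul0r.
  by rewrite -/(word s) wordM.
by rewrite nmulDr nmulZr IHu IHv.
Qed.

Lemma word_nilr : right_id (word [::]) nmul.
Proof.
elim/free_mod_ind => [|s|a u v IHu IHv]; first by rewrite nmul0l.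
  by rewrite -/(word s) wordM cats0.
by rewrite nmulDl nmulZl IHu IHv.
Qed.

HB.instance Definition _ := NAlgebra_isUnital.Build A free_alg word_nill word_nilr.

End FreeAlgebra.

Section QuotientUnit.
Context (R : comPzRingType) (V : ualgType R) (I : ideal V).

Let qnid : quot_alg I := qclass I nid.
Let qmul1l : left_id qnid nmul.
Proof. by move=> u; rewrite -[u]qreprK -qclassM nmul1l. Qed.
Let qmul1r : right_id qnid nmul.
Proof. by move=> u; rewrite -[u]qreprK -qclassM nmul1r. Qed.
HB.instance Definition _ := NAlgebra_isUnital.Build R (quot_alg I) qmul1l qmul1r.

End QuotientUnit.

(* (x y x ...) with m factors *)
Fixpoint alternate (T : Type) (op : T -> T -> T) (e : T) (m : nat) (x y : T) : T :=
  if m is n.+1 then op x (alternate op e n y x) else e.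

Definition has_order (G : groupType) (g : G) (m : nat) :=
  [/\ (0 < m)%N, (g ^+ m = 1)%g & forall k, (0 < k < m)%N -> (g ^+ k <> 1)%g].

(* W is presented by the set S of involutions with relations (rs)^m = 1,
   m < oo the order of rs in W. *)
Definition coxeter_system (W : groupType) (S : set W) :=
  (forall r : S, has_order (val r) 2) /\
  forall (G : groupType) (f : S -> G),
    (forall (r s : S) m, has_order (val r * val s)%g m -> ((f r * f s) ^+ m = 1)%g) ->
    exists! phi : W -> G,
      {morph phi : x y / (x * y)%g} /\ forall r : S, phi (val r) = f r.

Record heckeDatum := HeckeDatum {
  hd_W : groupType;
  hd_S : set hd_W;
  hd_coxeter : coxeter_system hd_S;
  hd_A : comPzRingType;
  hd_a : hd_S -> hd_A;
  hd_b : hd_S -> hd_A;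
  hd_a_conj : forall (r s : hd_S) (w : hd_W),
    val r = (val s ^ w)%g -> hd_a r = hd_a s;
  hd_b_conj : forall (r s : hd_S) (w : hd_W),
    val r = (val s ^ w)%g -> hd_b r = hd_b s
}.

Arguments hd_S : clear implicits.

(* m_{r,s} = m < oo *)
Definition hd_order (D : heckeDatum) (r s : hd_S D) (m : nat) :=
  has_order (val r * val s)%g m.

Section HeckeAlgebra.
Context (D : heckeDatum).
Local Notation A := (hd_A D).
Local Notation S := (hd_S D).
Local Notation F := (free_alg A S).

Let t (r : S) : F := word A [:: r].

Inductive hecke_relator : set F :=
| BraidRelator (r s : S) (m : nat) of r <> s & hd_order r s m :
    hecke_relator (alternate nmul nid m (t r) (t s) - alternate nmul nid m (t s) (t r))
| QuadraticRelator (r : S) :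
    hecke_relator ((t r - hd_a r *: nid) ** (t r + hd_b r *: nid)).

Definition hecke_alg : ualgType A := quot_alg (ideal_gen hecke_relator).

Definition hecke_gen (r : S) : hecke_alg := qclass _ (t r).

End HeckeAlgebra.

(* The subring A0 of A is given as a subtype ehd_A0 of A with underlying
   predicate ehd_mem; ehd_c is the chosen basis of A over A0. *)
Record extHeckeDatum := ExtHeckeDatum {
  ehd_datum :> heckeDatum;
  ehd_mem : {pred hd_A ehd_datum};
  ehd_A0 : subComPzRingType ehd_mem;
  ehd_I : choiceType;
  ehd_c : ehd_I -> hd_A ehd_datum;
  ehd_basis : forall a : hd_A ehd_datum, exists! x : free_mod ehd_A0 ehd_I,
    a = \sum_(i \in [set: ehd_I]) ehd_c i * val (x i)
}.

Record preGraph (D : heckeDatum) := PreGraph {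
  pg_quiver :> quiver;
  pg_label : vertex pg_quiver -> set (hd_S D);
  pg_finite : forall (x : vertex pg_quiver) (r : hd_S D), ~ pg_label x r ->
    finite_set [set e : edge pg_quiver | target e = x /\ pg_label (source e) r]
}.

Section Rho.
Context (D : heckeDatum) (Q : preGraph D).
Local Notation A := (hd_A D).
Local Notation S := (hd_S D).

Definition rho_vertex (r : S) (x : vertex Q) : path_alg A Q :=
  if `[< pg_label x r >] then - hd_b r *: pbasis A (vertex_path x)
  else hd_a r *: pbasis A (vertex_path x) +
       \sum_(e \in [set e : edge Q | target e = x /\ pg_label (source e) r])
         pbasis A (edge_path e).

Definition rho (r : S) : {linear path_alg A Q -> path_alg A Q} :=
  left_ext (rho_vertex r).

Definition rho_braid (r s : S) (m : nat) (x : vertex Q) : path_alg A Q :=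
  let comp f g : path_alg A Q -> path_alg A Q := f \o g in
  alternate comp id m (rho r) (rho s) (pbasis A (vertex_path x)) -
  alternate comp id m (rho s) (rho r) (pbasis A (vertex_path x)).

End Rho.

Section QuotientPathAlgebra.
Context (D : extHeckeDatum) (Q : preGraph D).
Local Notation A := (hd_A D).
Local Notation S := (hd_S D).
Local Notation A0 := (ehd_A0 D).
Local Notation I := (ehd_I D).

Definition coord (a : A) : free_mod A0 I := sval (cid (ehd_basis a)).

Lemma coordE (a : A) : a = \sum_(i \in [set: I]) ehd_c i * val (coord a i).
Proof. by rewrite /coord; case: cid => x []. Qed.

Lemma coord0 : coord 0 = 0.
Proof.
rewrite /coord; case: cid => x [/= _ xu]; apply: xu; rewrite fsbig1// => i _.
by rewrite -[(0 : free_mod A0 I) i]/(0 : A0) raddf0 mulr0.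
Qed.

Lemma path_coord_subproof (v : path_alg A Q) (i : I) :
  (fun p => coord (fcoef v p) i) \in @fin_supp A0 (qpath Q).
Proof.
apply/asboolP; apply: sub_finite_set (fcoef_finite v) => p /=.
by apply: contraNN => /eqP ->; rewrite coord0.
Qed.

(* The element with coefficients X_{p,i}, p a path, where
   v = sum_i sum_p c_i X_{p,i} p *)
Definition path_coord (v : path_alg A Q) (i : I) : path_alg A0 Q :=
  FreeMod (path_coord_subproof v i).

Inductive J0_gen : set (path_alg A0 Q) :=
| J0Gen (r s : S) (m : nat) (x : vertex Q) (i : I) of r <> s & hd_order r s m :
    J0_gen (path_coord (rho_braid r s m x) i).

Definition J0 : ideal (path_alg A0 Q) := ideal_gen J0_gen.

Definition calR0 : nalgType A0 := quot_alg J0.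

Lemma path_incl_subproof (v : path_alg A0 Q) :
  (fun p => val (fcoef v p)) \in @fin_supp A (qpath Q).
Proof.
apply/asboolP; apply: sub_finite_set (fcoef_finite v) => p /=.
by apply: contraNN => /eqP ->; rewrite raddf0.
Qed.

(* The inclusion of A0[Q] in A[Q] *)
Definition path_incl (v : path_alg A0 Q) : path_alg A Q :=
  FreeMod (path_incl_subproof v).

Lemma path_incl_linear (a : A0) u v :
  path_incl (a *: u + v) = val a *: path_incl u + path_incl v.
Proof.
apply: free_modP => p.
rewrite -[LHS]/(val (a * fcoef u p + fcoef v p)).
by rewrite rmorphD rmorphM.
Qed.

Lemma path_incl0 : path_incl 0 = 0.
Proof. by apply: free_modP => p; rewrite -[LHS]/(val (0 : A0)) raddf0. Qed.

Lemma path_inclD u v : path_incl (u + v) = path_incl u + path_incl v.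
Proof. by rewrite -[u in LHS]scale1r path_incl_linear rmorph1 scale1r. Qed.

Lemma path_inclZ a u : path_incl (a *: u) = val a *: path_incl u.
Proof. by rewrite -[a *: u]addr0 path_incl_linear path_incl0 addr0. Qed.

Lemma path_inclB u v : path_incl (u - v) = path_incl u - path_incl v.
Proof. by apply: (addIr (path_incl v)); rewrite -path_inclD !subrK. Qed.

Lemma path_incl_basis p : path_incl (pbasis A0 p) = pbasis A p.
Proof.
apply: free_modP => q; rewrite /= ; case: eqP => _; first exact: rmorph1.
exact: raddf0.
Qed.

Lemma path_inclM u v : path_incl (u ** v) = path_incl u ** path_incl v.
Proof.
elim/free_mod_ind: u => [|p|a u1 u2 IH1 IH2].
- by rewrite nmul0l path_incl0 nmul0l.
- elim/free_mod_ind: v => [|q|a v1 v2 IH1 IH2].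
  + by rewrite nmul0r path_incl0 nmul0r.
  + rewrite -/(pbasis A0 p) -/(pbasis A0 q) !path_incl_basis !pbasisM.
    by case: path_cat => [pq|] /=; rewrite ?path_incl_basis ?path_incl0.
  + by rewrite nmulDr nmulZr !path_incl_linear nmulDr nmulZr IH1 IH2.
- by rewrite nmulDl nmulZl !path_incl_linear nmulDl nmulZl IH1 IH2.
Qed.

(* J is the image of A (x) J0 in A[Q], that is, the A-span of J0. *)
Definition J_set : set (path_alg A Q) :=
  [set v | exists2 s : seq (A * path_alg A0 Q), (forall x, x \in s -> J0 x.2)
         & v = \sum_(x <- s) x.1 *: path_incl x.2].

Lemma J_set0 : J_set 0.
Proof. by exists [::] => //; rewrite big_nil. Qed.

Lemma J_setD u v : J_set u -> J_set v -> J_set (u + v).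
Proof.
move=> [s sJ ->] [t tJ ->]; exists (s ++ t); last by rewrite big_cat.
by move=> x; rewrite mem_cat => /orP[/sJ|/tJ].
Qed.

Lemma J_set_incl a w : J0 w -> J_set (a *: path_incl w).
Proof.
by move=> Jw; exists [:: (a, w)]; rewrite ?big_seq1// => x; rewrite inE => /eqP->.
Qed.

Lemma J_set_sum T (s : seq T) (F : T -> path_alg A Q) :
  (forall x, J_set (F x)) -> J_set (\sum_(x <- s) F x).
Proof. by move=> JF; elim/big_ind: _ => //; [exact: J_set0|exact: J_setD]. Qed.

Lemma J_set_ind (P : path_alg A Q -> Prop) :
  P 0 -> (forall u v, P u -> P v -> P (u + v)) ->
  (forall a w, J0 w -> P (a *: path_incl w)) -> forall v, J_set v -> P v.
Proof.
move=> P0 PD PJ _ [s sJ ->]; rewrite big_seq; elim/big_ind: _ => // x /sJ.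
exact: PJ.
Qed.

Lemma J_setZ a v : J_set v -> J_set (a *: v).
Proof.
move: v; apply: J_set_ind => [|u v|b w Jw].
- by rewrite scaler0; exact: J_set0.
- by rewrite scalerDr; exact: J_setD.
- by rewrite scalerA; exact: J_set_incl.
Qed.

Lemma J_set_mull u v : J_set v -> J_set (u ** v).
Proof.
move: v; apply: J_set_ind => [|v1 v2 J1 J2|b w Jw].
- by rewrite nmul0r; exact: J_set0.
- by rewrite nmulDr; exact: J_setD.
- rewrite nmulZr; apply: J_setZ.
  elim/free_mod_ind: u => [|p|a u1 u2 IH1 IH2].
  + by rewrite nmul0l; exact: J_set0.
  + rewrite -/(pbasis A p) -path_incl_basis -path_inclM -[path_incl _]scale1r.
    exact/J_set_incl/ideal_mull.
  + by rewrite nmulDl nmulZl; apply: J_setD => //; exact: J_setZ.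
Qed.

Lemma J_set_mulr u v : J_set v -> J_set (v ** u).
Proof.
move: v; apply: J_set_ind => [|v1 v2 J1 J2|b w Jw].
- by rewrite nmul0l; exact: J_set0.
- by rewrite nmulDl; exact: J_setD.
- rewrite nmulZl; apply: J_setZ.
  elim/free_mod_ind: u => [|p|a u1 u2 IH1 IH2].
  + by rewrite nmul0r; exact: J_set0.
  + rewrite -/(pbasis A p) -path_incl_basis -path_inclM -[path_incl _]scale1r.
    exact/J_set_incl/ideal_mulr.
  + by rewrite nmulDr nmulZr; apply: J_setD => //; exact: J_setZ.
Qed.

Definition J : ideal (path_alg A Q) :=
  Ideal J_set0 J_setD J_setZ J_set_mull J_set_mulr.

Definition calR : nalgType A := quot_alg J.

Lemma left_ext_ideal (K : ideal (path_alg A Q)) g u : K u -> K (left_ext g u).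
Proof.
have [X] : exists X : {fset vertex Q}, forall Y : {fset vertex Q}, (X `<=` Y)%fset ->
    left_ext g u = \sum_(x <- Y) u ** pbasis A (vertex_path x) ** g x.
  elim/free_mod_ind: u => [|p|a u1 u2 [X1 IH1] [X2 IH2]].
  - exists fset0 => Y _; rewrite linear0 big1// => x _; by rewrite !nmul0l.
  - exists [fset path_source p]%fset => Y; rewrite fsub1set => pY.
    rewrite -/(pbasis A p) left_ext_basis (big_fsetD1 _ pY)/= big1_fset ?addr0.
      by rewrite pbasisM path_cat_vertexr.
    move=> x; rewrite !inE => /andP[xp _] _; rewrite pbasisM.
    by case: path_catP => [pq E|] /=; [rewrite E eqxx in xp|rewrite nmul0l].
  - exists (X1 `|` X2)%fset => Y; rewrite fsubUset => /andP[X1Y X2Y].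
    rewrite linearP (IH1 _ X1Y) (IH2 _ X2Y) scaler_sumr -big_split.
    by apply: eq_bigr => x _ /=; rewrite !nmulDl !nmulZl.
move=> /(_ X (fsubset_refl X)) -> Ku; elim/big_ind: _ => [||x _].
- exact: ideal0.
- exact: idealD.
- exact/ideal_mulr/ideal_mulr.
Qed.

Definition rho_tilde (r : S) : {linear calR -> calR} :=
  quot_map (@left_ext_ideal J (rho_vertex r)).

Definition path_class (p : qpath Q) : calR := qclass J (pbasis A p).

Lemma rho_tilde_class r v : rho_tilde r (qclass J v) = qclass J (rho Q r v).
Proof. exact: (qmap_class (@left_ext_ideal J (rho_vertex r))). Qed.

Lemma rho_tilde_endo r : left_endo (rho_tilde r).
Proof.
move=> u v; rewrite -[u]qreprK -[v]qreprK -qclassM !rho_tilde_class.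
by rewrite -qclassM; congr (qclass J _); exact: left_ext_endo.
Qed.

Lemma rho_tilde_vertex r x :
  rho_tilde r (path_class (vertex_path x)) =
  if `[< pg_label x r >] then - hd_b r *: path_class (vertex_path x)
  else hd_a r *: path_class (vertex_path x) +
       \sum_(e \in [set e : edge Q | target e = x /\ pg_label (source e) r])
         path_class (edge_path e).
Proof.
rewrite rho_tilde_class left_ext_vertex /rho_vertex; last first.
  have xx : path_cat (vertex_path x) (vertex_path x) = Some (vertex_path x).
    exact: (path_cat_vertexl (vertex_path x)).
  case: asboolP => [_|xr]; first by rewrite nmulZr pbasisM xx.
  rewrite nmulDr nmulZr pbasisM xx /=; congr (_ + _).
  rewrite !(fsbig_finite _ _ (pg_finite xr)) /= nmul_sumr big_seq [RHS]big_seq.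
  apply: eq_bigr => e; rewrite in_fset_set ?inE; last exact: pg_finite.
  move=> [<- _]; rewrite pbasisM.
  by rewrite -[target e]/(path_target (edge_path e)) path_cat_vertexl.
case: asboolP => [_|xr]; first exact: linearZ.
by rewrite !(fsbig_finite _ _ (pg_finite xr)) /= linearP linear_sum.
Qed.

(* calR is A (x)_{A0} calR0: the A0-linear map class_incl from calR0 to calR is
   universal among the A0-linear maps to A-modules. *)
Definition class_incl (u : calR0) : calR := qclass J (path_incl (qrepr u)).

Lemma class_incl_class v : class_incl (qclass J0 v) = qclass J (path_incl v).
Proof.
apply/qclassP; rewrite -path_inclB -[path_incl _]scale1r.
exact/J_set_incl/qrepr_class.
Qed.

Lemma class_inclM u v : class_incl (u ** v) = class_incl u ** class_incl v.
Proof.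
rewrite -[u]qreprK -[v]qreprK -qclassM !class_incl_class -qclassM.
by rewrite path_inclM.
Qed.

Lemma calR_tensor (M : lmodType A) (f : calR0 -> M) :
  (forall (a : A0) u v, f (a *: u + v) = val a *: f u + f v) ->
  exists2 g : {linear calR -> M}, (forall u, g (class_incl u) = f u)
    & forall h : {linear calR -> M}, (forall u, h (class_incl u) = f u) -> h =1 g.
Proof.
move=> f_lin.
pose g0 : {linear path_alg A Q -> M} :=
  @lext A _ M (fun p => f (qclass J0 (pbasis A0 p))).
have f0 : f 0 = 0.
  have := f_lin 1 0 0; rewrite scale1r addr0 rmorph1 scale1r => H.
  by apply: (addrI (f 0)); rewrite addr0 -H.
have g0_incl v : g0 (path_incl v) = f (qclass J0 v).
  elim/free_mod_ind: v => [|p|a v w IHv IHw].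
  - by rewrite path_incl0 !linear0 f0.
  - by rewrite path_incl_basis /g0 lext_basis.
  - by rewrite path_incl_linear !linearP f_lin IHv IHw.
have g0J v : J v -> g0 v = 0.
  move: v; apply: J_set_ind => [|u v gu gv|a w Jw].
  - exact: linear0.
  - by rewrite linearD gu gv addr0.
  - by rewrite linearZ /= g0_incl (qclass0P J0 w).2// f0 scaler0.
pose g1 (u : calR) : M := g0 (qrepr u).
have g1_class v : g1 (qclass J v) = g0 v.
  by apply/eqP; rewrite /g1 -subr_eq0 -linearB g0J//; exact: qrepr_class.
have g1_lin : linear g1.
  by move=> a u v; rewrite -[u]qreprK -[v]qreprK -linearP !g1_class linearP.
pose g1L := GRing.isLinear.Build A calR M _ g1 g1_lin.
pose g : {linear calR -> M} := HB.pack g1 g1L.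
exists g => [u|h hf u].
  by rewrite -[u]qreprK class_incl_class [LHS]g1_class g0_incl.
rewrite -[u]qreprK [RHS]g1_class.
elim/free_mod_ind: (qrepr u) => [|p|a v w IHv IHw].
- by rewrite !linear0.
- rewrite -/(pbasis A p) -path_incl_basis -class_incl_class hf.
  by rewrite path_incl_basis /g0 lext_basis.
- by rewrite !linearP IHv IHw.
Qed.

End QuotientPathAlgebra.

(* Main.v *)
(** By the universal property of the presentation of H(D), it suffices that the
    operators rho~_r satisfy the quadratic and the braid relations. All these
    operators are left R-module endomorphisms and [p] = [p][x] for a path p with
    source x, so the relations need only be tested on the classes [x] of
    vertices. The quadratic relation already holds in A[Gamma], because r is in
    the label of the source of every edge that occurs in rho_r(x). The braid
    relation holds modulo J, because the defect at x is
    sum_i c_i (sum_p X_{p,i} p) and the inner sums generate J_0. *)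
Require Import Defs.
From HB Require Import structures.
From mathcomp Require Import all_boot all_algebra classical_sets.
From mathcomp Require Import finmap boolp cardinality fsbigop.
Local Open Scope ring_scope.

Set Implicit Arguments.
Unset Strict Implicit.
Import GRing.Theory.

(** The elements acting as zero under [rho] form a two-sided ideal [K]. It contains [G], hence
    [ideal_gen G], so the operator [rho h] depends only on the class of [h]. *)
Lemma ex_rep_quot (R : comPzRingType) (V : ualgType R) (M : lmodType R)
    (G : set V) (rho : representation V M) :
  (forall g v, G g -> rho g v = 0) ->
  exists rep : representation (quot_alg (ideal_gen G)) M,
    forall h, rep (qclass _ h) =1 rho h.
Proof.
move=> rhoG.
have kerM0 : forall v, rho 0 v = 0.
  by move=> v; rewrite -[0](scale0r 0) repZ scale0r.
have kerD h k : (forall v, rho h v = 0) -> (forall v, rho k v = 0) ->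
    forall v, rho (h + k) v = 0.
  by move=> h0 k0 v; rewrite repD h0 k0 addr0.
have kerZ a h : (forall v, rho h v = 0) -> forall v, rho (a *: h) v = 0.
  by move=> h0 v; rewrite repZ h0 scaler0.
have kerMl k h : (forall v, rho h v = 0) -> forall v, rho (k ** h) v = 0.
  by move=> h0 v; rewrite repM h0 linear0.
have kerMr k h : (forall v, rho h v = 0) -> forall v, rho (h ** k) v = 0.
  by move=> h0 v; rewrite repM h0.
pose K := Ideal kerM0 kerD kerZ kerMl kerMr.
have repr_class h : rho (qrepr (qclass (ideal_gen G) h)) =1 rho h.
  move=> v; apply/eqP; rewrite -subr_eq0 -scaleN1r -repZ -repD scaleN1r.
  (* Membership in ideal_gen G, instantiated at the kernel K of rho. *)
  by apply/eqP/(@qrepr_class _ _ (ideal_gen G) h K) => g Gg w; exact: rhoG.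
unshelve eexists.
  exists (fun h => rho (qrepr h)).
  - by move=> v; rewrite repr_class rep1.
  - move=> h k v; rewrite -{1}[h]qreprK -{1}[k]qreprK -qclassM repr_class.
    exact: repM.
  - move=> h k v; rewrite -{1}[h]qreprK -{1}[k]qreprK -qclassD repr_class.
    exact: repD.
  - move=> a h v; rewrite -{1}[h]qreprK -qclassZ repr_class.
    exact: repZ.
by move=> h; exact: repr_class.
Qed.

Section FreeRepresentation.
Context (A : comPzRingType) (S : choiceType) (M : lmodType A).
Context (f : S -> {linear M -> M}).

(** The leftmost letter acts last, so that concatenation of words becomes composition of
    operators. *)
Definition word_act (w : seq S) (v : M) : M := foldr (fun r => f r) v w.

Definition free_act (h : free_alg A S) (v : M) : M :=
  lext (fun w => word_act w v) h.

Lemma free_act_word w v : free_act (word A w) v = word_act w v.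
Proof. exact: lext_basis. Qed.

Lemma free_actP a h k v :
  free_act (a *: h + k) v = a *: free_act h v + free_act k v.
Proof. exact: linearP. Qed.

Lemma free_act0 v : free_act 0 v = 0.
Proof. exact: linear0. Qed.

Lemma word_act_linear w : linear (word_act w).
Proof. by move=> a u v; elim: w => //= r w ->; rewrite linearP. Qed.

Lemma free_act_linear h : linear (free_act h).
Proof.
move=> a u v; elim/free_mod_ind: h => [|w|b h k IHh IHk].
- by rewrite !free_act0 scaler0 addr0.
- by rewrite -/(word A w) !free_act_word word_act_linear.
(* The scalars [a] and [b] are exchanged by commutativity of [A]. *)
- rewrite !free_actP IHh IHk !scalerDr !scalerA mulrC.
  by rewrite !addrA; congr (_ + _); rewrite addrAC.
Qed.

HB.instance Definition _ h :=
  GRing.isLinear.Build A M M _ (free_act h) (free_act_linear h).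

Lemma free_actM h k v : free_act (h ** k) v = free_act h (free_act k v).
Proof.
elim/free_mod_ind: h => [|w|a h1 h2 IH1 IH2].
- by rewrite nmul0l !free_act0.
- elim/free_mod_ind: k => [|w'|a k1 k2 IH1 IH2].
  + by rewrite nmul0r !free_act0 linear0.
  + rewrite -/(word A w) -/(word A w') wordM !free_act_word.
    exact: foldr_cat.
  + by rewrite nmulDr nmulZr !free_actP IH1 IH2 linearP.
- by rewrite nmulDl nmulZl !free_actP IH1 IH2.
Qed.

(** Kept transparent, since [free_rep] and [free_act] are converted into each other below. *)
Definition free_rep : representation (free_alg A S) M.
Proof.
exists (fun h => free_act h : {linear M -> M}).
- by move=> v; exact: free_act_word.
- exact: free_actM.
- by move=> h k v; exact: linearD.
- by move=> a h v; exact: linearZ.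
Defined.

Lemma free_rep_gen r : free_rep (word A [:: r]) =1 f r.
Proof. by move=> v; exact: free_act_word. Qed.

End FreeRepresentation.

(** An intertwiner for the generators intertwines all words, hence their linear combinations. It is
    applied to left multiplications and to the projection of the path algebra onto [calR]. *)
Lemma free_act_morph (A : comPzRingType) (S : choiceType) (M N : lmodType A)
    (f : S -> {linear M -> M}) (f' : S -> {linear N -> N})
    (c : {linear M -> N}) :
  (forall r v, f' r (c v) = c (f r v)) ->
  forall h v, free_act f' h (c v) = c (free_act f h v).
Proof.
move=> fc h v; elim/free_mod_ind: h => [|w|a h k IHh IHk].
- by rewrite !free_act0 linear0.
- rewrite -/(word A w) !free_act_word.
  by elim: w => //= r w ->; exact: fc.
- by rewrite !free_actP IHh IHk linearP.
Qed.

Lemma free_act_left_endo (A : comPzRingType) (S : choiceType) (V : nalgType A)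
    (f : S -> {linear V -> V}) :
  (forall r, left_endo (f r)) -> forall h, left_endo (free_act f h).
Proof.
move=> fE h u v.
have uL : linear (nmul u) by move=> a x y; rewrite nmulDr nmulZr.
pose ul : {linear V -> V} := HB.pack (nmul u)
  (GRing.isLinear.Build A V V _ (nmul u) uL).
by apply: (free_act_morph (c := ul)) => r w; exact: fE.
Qed.

(** Links braid relators, alternating products in an algebra, to the composites of operators in
    [rho_braid]. *)
Lemma alternate_rep (R : comPzRingType) (H : ualgType R) (M : lmodType R)
    (rho : representation H M) m h k v :
  rho (alternate nmul nid m h k) v =
  alternate (fun f g : M -> M => f \o g) id m (rho h) (rho k) v.
Proof.
by elim: m h k => [|m IHm] h k /=; [rewrite rep1|rewrite repM IHm].
Qed.

Section HeckeAction.
Context (D : extHeckeDatum) (Q : preGraph D).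
Local Notation A := (hd_A D).
Local Notation S := (hd_S D).

(** Every edge in the sum [rho_vertex r x] has target [x], so left multiplication by [x] fixes
    [rho_vertex r x]. *)
Lemma rho_vertex_basis (r : S) (x : vertex Q) :
  rho Q r (pbasis A (vertex_path x)) = rho_vertex r x.
Proof.
rewrite left_ext_vertex /rho_vertex//.
have xx : path_cat (vertex_path x) (vertex_path x) = Some (vertex_path x).
  exact: (path_cat_vertexl (vertex_path x)).
case: asboolP => [_|xr]; first by rewrite nmulZr pbasisM xx.
rewrite nmulDr nmulZr pbasisM xx /=; congr (_ + _).
rewrite !(fsbig_finite _ _ (pg_finite xr)) /= nmul_sumr big_seq [RHS]big_seq.
apply: eq_bigr => e; rewrite in_fset_set; last exact: pg_finite.
move=> /set_mem[<- _]; rewrite pbasisM.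
by rewrite -[target e]/(path_target (edge_path e)) path_cat_vertexl.
Qed.

Lemma pbasis_source p :
  pbasis A p ** pbasis A (vertex_path (path_source p)) = pbasis A p
    :> path_alg A Q.
Proof. by rewrite pbasisM path_cat_vertexr. Qed.

(** If [r] labels [x], then [u = 0]. Otherwise [u = (a_r + b_r) x + w] with [w] the sum of edges in
    [rho_vertex r x], and [rho r w = - b_r w] gives the claim. *)
Lemma rho_quadratic_vertex (r : S) (x : vertex Q) :
  let v := pbasis A (vertex_path x) in
  let u := rho Q r v + hd_b r *: v in rho Q r u = hd_a r *: u.
Proof.
move=> v; have := rho_vertex_basis r x.
rewrite -/v /rho_vertex -/v; case: asboolP => xr rv /=.
  by rewrite rv scaleNr addNr linear0 scaler0.
move: rv; rewrite fsbig_finite /=; last exact: pg_finite.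
set E := fset_set _; set w := \sum_(e <- E) _ => rv.
(* For each edge [e] of [w], [rho r e = e ** rho_vertex r (source e)], and [r] labels [source e]. *)
have rw : rho Q r w = - hd_b r *: w.
  rewrite /w linear_sum scaler_sumr big_seq [RHS]big_seq; apply: eq_bigr => e.
  rewrite in_fset_set; last exact: pg_finite.
  move=> /set_mem[_ er]; rewrite -[LHS]/(left_ext _ _) left_ext_basis.
  rewrite /rho_vertex asboolT// nmulZr.
  by rewrite (pbasis_source (edge_path e)).
rewrite rv linearD linearD !linearZ /= rv rw.
rewrite !scalerDr !scaleNr !scalerA [hd_b r * _]mulrC.
by rewrite [X in _ + X = _]addrC !addrA subrK.
Qed.

(** One finite list of indices serves all paths: the union, over the finite support of [v], of the
    supports of the coordinates of its coefficients. *)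
Lemma path_alg_coordE (v : path_alg A Q) : exists s : seq (ehd_I D),
  v = \sum_(i <- s) ehd_c i *: path_incl (path_coord v i).
Proof.
pose X := fset_set [set p | fcoef v p != 0]%classic.
pose Y (p : qpath Q) := fset_set [set i | Defs.coord (fcoef v p) i != 0]%classic.
pose Z := (\bigcup_(p <- X) Y p)%fset.
exists Z; apply: free_modP => p.
have -> : fcoef (\sum_(i <- Z) ehd_c i *: path_incl (path_coord v i)) p =
    \sum_(i <- Z) ehd_c i * val (Defs.coord (fcoef v p) i).
  by elim/big_ind2: _ => // x1 x2 y1 y2 <- <-.
rewrite [LHS]coordE; apply: fsbigTE => i.
case: (eqVneq (Defs.coord (fcoef v p) i) 0) => [->|ci].
  by rewrite raddf0 mulr0.
case/negP; apply/bigfcupP; exists p; last first.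
  by rewrite in_fset_set ?mem_set//; exact: fcoef_finite.
rewrite in_fset_set ?mem_set// ?andbT; last exact: fcoef_finite.
by rewrite /=; apply: contraNN ci => /eqP ->; rewrite Defs.coord0.
Qed.

Lemma J_rho_braid (r s : S) m (x : vertex Q) : r <> s -> hd_order r s m ->
  J_set (rho_braid r s m x).
Proof.
move=> rs rsm; have [t ->] := path_alg_coordE (rho_braid r s m x).
by apply: J_set_sum => i; apply: J_set_incl => I; apply; exact: J0Gen.
Qed.

(** With infinitely many vertices [calR] may lack an identity; the class of the source of a path
    acts as a right unit on the class of that path. *)
Lemma left_endo_calR0 (f : {linear calR Q -> calR Q}) : left_endo f ->
  (forall x, f (path_class (vertex_path x)) = 0) -> forall v, f v = 0.
Proof.
move=> fE f0 v; rewrite -[v]qreprK.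
elim/free_mod_ind: (qrepr v) => [|p|a u w IHu IHw].
- by rewrite !linear0.
- by rewrite -/(pbasis A p) -pbasis_source qclassM fE f0 nmul0r.
- by rewrite !linearP IHu IHw scaler0 addr0.
Qed.

Lemma hecke_relator_act (g : free_alg A S) (v : calR Q) :
  hecke_relator g -> free_rep (@rho_tilde D Q) g v = 0.
Proof.
move=> Hg; rewrite /free_rep /=; move: v.
apply: left_endo_calR0; first by apply: free_act_left_endo; exact: rho_tilde_endo.
(* The projection intertwines [rho] with [rho_tilde], so it remains to show that the value at [x]
   computed in the path algebra lies in [J]. *)
move=> x; rewrite /= (free_act_morph (f := rho Q) (c := qclass (J Q)));
  last exact: rho_tilde_class.
apply/qclass0P; rewrite -[free_act _ _ _]/(free_rep (rho Q) g _).
have repB h k w : free_rep (rho Q) (h - k) w =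
    free_rep (rho Q) h w - free_rep (rho Q) k w.
  by rewrite -[- k]scaleN1r repD repZ scaleN1r.
case: Hg => [r s m rs rsm|r].
  rewrite repB !alternate_rep.
  rewrite (funext (free_rep_gen (rho Q) r)) (funext (free_rep_gen (rho Q) s)).
  exact: J_rho_braid.
(* With [u = rho r x + b_r x], the quadratic relator sends [x] to [rho r u - a_r u]. *)
rewrite repM repB repD !repZ !rep1 !free_rep_gen.
by rewrite rho_quadratic_vertex subrr; exact: J_set0.
Qed.

End HeckeAction.

Theorem proposition4p3 (D : extHeckeDatum) (Q : preGraph D) :
  exists rep : representation (hecke_alg D) (calR Q),
    forall r : hd_S D, rep (hecke_gen r) =1 rho_tilde Q r.
Proof.
have [rep repE] := ex_rep_quot (@hecke_relator_act D Q).
by exists rep => r v; rewrite repE free_rep_gen.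
Qed.
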